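(* Let $G$ and $H$ be étale groupoids with invariant measures $\mu$ on $G^{(0)}$ and $\eta$ on $H^{(0)}$ respectively, and let $M$ be a Morita equivalence between them. Let $\mu'$ be the measure on $H^{(0)}$ obtained by inducing $\mu$ to $M$ and then passing to the quotient $H^{(0)}\cong G\backslash M$, and let $\eta'$ be the measure on $G^{(0)}$ obtained by inducing $\eta$ to $M$ and then passing to the quotient $G^{(0)}\cong M/H$. If $\mu'$ is absolutely continuous with respect to $\eta$ and $\eta'$ is absolutely continuous with respect to $\mu$, then $(G,\nu_\mu)$ and $(H,\nu_\eta)$ are Morita equivalent as measured groupoids.
   Context: Étale groupoids are locally compact Hausdorff, and measures are positive Radon measures. A Morita equivalence between $G$ and $H$ is a locally compact Hausdorff space $M$ with continuous maps $p:M\to G^{(0)}$, $q:M\to H^{(0)}$, which are the anchor maps of commuting free and proper left $G$- and right $H$-actions on $M$, such that $p$ and $q$ induce homeomorphisms $M/H\cong G^{(0)}$ and $G\backslash M\cong H^{(0)}$. **Induced and quotient measures.** For a free and proper left $G$-space $M$, $G$-invariant Radon measures $\rho$ on $M$ correspond bijectively to Radon measures $m$ on $G\backslash M$: given $m$, the induced measure is $$\rho(f)=\int_{G\backslash M}\Big(\sum_{\gamma\in G,\ r(\gamma)=p(x)}f(\gamma^{-1}x)\Big)\,dm([x]),\qquad f\in C_c(M),$$ and $m$ is called the quotient measure of $\rho$; likewise for right $H$-actions. The measure $\mu$ on $G^{(0)}\cong M/H$ is induced to $M$ through the $H$-action; as $\mu$ is $G$-invariant, the resulting measure on $M$ is also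 $G$-invariant and so has a quotient measure $\mu'$ on $G\backslash M\cong H^{(0)}$. Symmetrically, $\eta$ on $H^{(0)}\cong G\backslash M$ is induced to $M$ through the $G$-action and has the quotient measure $\eta'$ on $M/H\cong G^{(0)}$. A measure $\mu$ on $G^{(0)}$ is invariant if the measure $\nu_\mu$ on $G$, $\int f\,d\nu_\mu=\int\sum_{s(\gamma)=x}f(\gamma)\,d\mu(x)$, is invariant under $\gamma\mapsto\gamma^{-1}$; $(G,\nu_\mu)$ is then a measured groupoid. Measured groupoids $(G,\nu_\mu)$ and $(H,\nu_\eta)$ are Morita equivalent if there is a measure space $(M,\rho)$ with commuting Borel left $G$- and right $H$-actions (with Borel anchor maps to $G^{(0)}$ and $H^{(0)}$) which leave $\rho$ quasi-invariant and are free and proper, such that the anchor maps induce isomorphisms, up to null sets, $M/H\cong G^{(0)}$ and $G\backslash M\cong H^{(0)}$, under which the measure classes obtained from $\rho$ on the quotients are those of $\mu$ and $\eta$ respectively. *)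

(* Defs.v *)
From HB Require Import structures.
From mathcomp Require Import all_boot all_order all_algebra generic_quotient.
From mathcomp Require Import all_classical all_reals all_analysis.

Set Implicit Arguments.
Unset Strict Implicit.
Unset Printing Implicit Defensive.

Import Order.TTheory GRing.Theory Num.Theory.
Import numFieldNormedType.Exports.

Local Open Scope classical_set_scope.
Local Open Scope ring_scope.
Local Open Scope quotient_scope.

(* [gmul] is a total function, but only its values on composable pairs
   (src x = rng y) are meaningful; G0 is embedded in G by [gone]. *)
Record groupoid (G G0 : Type) := Groupoid {
  src : G -> G0;
  rng : G -> G0;
  gone : G0 -> G;
  ginv : G -> G;
  gmul : G -> G -> G;
  src_one : forall u, src (gone u) = u;
  rng_one : forall u, rng (gone u) = u;
  src_inv : forall x, src (ginv x) = rng x;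
  rng_inv : forall x, rng (ginv x) = src x;
  src_mul : forall x y, src x = rng y -> src (gmul x y) = src y;
  rng_mul : forall x y, src x = rng y -> rng (gmul x y) = rng x;
  gmulA : forall x y z, src x = rng y -> src y = rng z ->
    gmul x (gmul y z) = gmul (gmul x y) z;
  gmul1 : forall x, gmul x (gone (src x)) = x;
  gone_mul : forall x, gmul (gone (rng x)) x = x;
  gmulV : forall x, gmul x (ginv x) = gone (rng x);
  gmulVx : forall x, gmul (ginv x) x = gone (src x)
}.

Lemma op_groupoidA (G G0 : Type) (g : groupoid G G0) (x y z : G) :
  rng g x = src g y -> rng g y = src g z ->
  gmul g (gmul g z y) x = gmul g z (gmul g y x).
Proof. by move=> xy yz; rewrite gmulA. Qed.

(* A right action of g is a left action of the opposite groupoid: x . k is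
   [act k x], defined when rng k is the anchor of x. *)
Definition op_groupoid (G G0 : Type) (g : groupoid G G0) : groupoid G G0 :=
  @Groupoid G G0 (rng g) (src g) (gone g) (ginv g) (fun x y => gmul g y x)
    (rng_one g) (src_one g) (rng_inv g) (src_inv g)
    (fun x y xy => rng_mul (esym xy)) (fun x y xy => src_mul (esym xy))
    (@op_groupoidA G G0 g) (gone_mul g) (gmul1 g) (gmulVx g) (gmulV g).

(* As for [gmul], [act k x] is meaningful only when src k = anchor x. *)
Record left_action (G G0 : Type) (g : groupoid G G0) (M : Type) := LeftAction {
  anchor : M -> G0;
  act : G -> M -> M;
  anchor_act : forall k x, src g k = anchor x -> anchor (act k x) = rng g k;
  act_one : forall x, act (gone g (anchor x)) x = x;
  act_mul : forall k l x, src g k = rng g l -> src g l = anchor x ->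
    act (gmul g k l) x = act k (act l x)
}.

Definition right_action (G G0 : Type) (g : groupoid G G0) (M : Type) :=
  left_action (op_groupoid g) M.

Definition same_orbit (G G0 M : Type) (g : groupoid G G0)
    (a : left_action g M) (x y : M) : Prop :=
  exists k, src g k = anchor a x /\ act a k x = y.

Definition free_action (G G0 M : Type) (g : groupoid G G0)
    (a : left_action g M) : Prop :=
  forall k x, src g k = anchor a x -> act a k x = x -> k = gone g (anchor a x).

Definition commuting_actions (G G0 H H0 M : Type) (g : groupoid G G0)
    (h : groupoid H H0) (a : left_action g M) (b : right_action h M) : Prop :=
  forall k x l, src g k = anchor a x -> rng h l = anchor b x ->
    [/\ anchor a (act b l x) = anchor a x,
        anchor b (act a k x) = anchor b x &
        act a k (act b l x) = act b l (act a k x)].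

Section orbit_space.
Context (G G0 : Type) (M : topologicalType) (g : groupoid G G0).
Context (a : left_action g M).

Definition orbit_rel : rel M := fun x y => `[< same_orbit a x y >].

Lemma orbit_rel_refl : reflexive orbit_rel.
Proof.
move=> x; apply/asboolP; exists (gone g (anchor a x)).
by rewrite src_one act_one.
Qed.

Lemma orbit_rel_sym : symmetric orbit_rel.
Proof.
suff S x y : orbit_rel x y -> orbit_rel y x by move=> x y; apply/idP/idP; exact: S.
move=> /asboolP[k [kx <-]]; apply/asboolP; exists (ginv g k).
rewrite src_inv anchor_act//; split=> //.
by rewrite -act_mul ?src_inv// gmulVx kx act_one.
Qed.

Lemma orbit_rel_trans : transitive orbit_rel.
Proof.
move=> y x z /asboolP[k [kx ky]] /asboolP[l [ly lz]]; apply/asboolP.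
have lk : src g l = rng g k by rewrite ly -ky anchor_act.
by exists (gmul g l k); rewrite src_mul// act_mul// ky.
Qed.

Definition orbit_equiv : equiv_rel M :=
  EquivRel orbit_rel orbit_rel_refl orbit_rel_sym orbit_rel_trans.

Definition orbit_space := quotient_topology {eq_quot orbit_equiv}.

End orbit_space.

Definition homeomorphism (X Y : topologicalType) (f : X -> Y) : Prop :=
  continuous f /\
  exists f' : Y -> X, [/\ cancel f f', cancel f' f & continuous f'].

Definition induces_homeo (G G0 : Type) (M Y : topologicalType)
    (g : groupoid G G0) (a : left_action g M) (q : M -> Y) : Prop :=
  (forall x y, same_orbit a x y -> q x = q y) /\
  homeomorphism (q \o repr : orbit_space a -> Y).

Definition locally_compact_hausdorff (X : topologicalType) : Prop :=
  locally_compact [set: X] /\ hausdorff_space X.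

Definition local_homeo (X Y : topologicalType) (f : X -> Y) : Prop :=
  continuous f /\
  forall x, exists U : set X, [/\ open U, U x, set_inj U f &
    forall V, V `<=` U -> open V -> open (f @` V)].

(* G0 is homeomorphic to the closed subset [gone g @` setT] of G, hence is
   locally compact Hausdorff as well. *)
Record etale_groupoid (G G0 : topologicalType) (g : groupoid G G0) : Prop :=
  EtaleGroupoid {
    etale_lch : locally_compact_hausdorff G;
    continuous_rng : continuous (rng g);
    continuous_one : continuous (gone g);
    continuous_inv : continuous (ginv g);
    continuous_mul : {within [set z : G * G | src g z.1 = rng g z.2],
      continuous (fun z => gmul g z.1 z.2)};
    local_homeo_src : local_homeo (src g)
  }.

Definition continuous_action (G G0 M : topologicalType) (g : groupoid G G0)
    (a : left_action g M) : Prop :=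
  continuous (anchor a) /\
  {within [set z : G * M | src g z.1 = anchor a z.2],
    continuous (fun z => act a z.1 z.2)}.

Definition proper_action (G G0 M : topologicalType) (g : groupoid G G0)
    (a : left_action g M) : Prop :=
  forall K : set (M * M), compact K ->
    compact [set z : G * M |
      src g z.1 = anchor a z.2 /\ K (act a z.1 z.2, z.2)].

Record morita_equivalence (G G0 H H0 M : topologicalType) (g : groupoid G G0)
    (h : groupoid H H0) (a : left_action g M) (b : right_action h M) : Prop :=
  MoritaEquivalence {
    morita_lch : locally_compact_hausdorff M;
    morita_continuousl : continuous_action a;
    morita_continuousr : continuous_action b;
    morita_commute : commuting_actions a b;
    morita_freel : free_action a;
    morita_freer : free_action b;
    morita_properl : proper_action a;
    morita_properr : proper_action b;
    morita_quotr : induces_homeo b (anchor a);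
    morita_quotl : induces_homeo a (anchor b)
  }.

Notation borel X := (g_sigma_algebraType (@open X)).

(* Positive linear functionals on C_c(X) correspond bijectively to the Borel
   measures that are finite on compact sets and inner regular on all Borel
   sets.  With inner regularity (rather than outer regularity), "null" means
   "locally null" when X is not sigma-compact. *)
Record radon_measure (R : realType) (X : ptopologicalType) := RadonMeasure {
  radon_val :> {measure set (borel X) -> \bar R};
  radon_finite : forall K : set X, compact K -> (radon_val K < +oo)%E;
  radon_inner : forall A : set (borel X), measurable A ->
    radon_val A =
      ereal_sup [set radon_val K | K in [set K : set X | compact K /\ K `<=` A]]
}.

Definition Cc (R : realType) (X : topologicalType) : set (X -> R) :=
  [set f | continuous f /\ compact (closure [set x | f x != 0])].

(* [nu] is the measure nu_mu on G.  The sums below have finite support since f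
   is in C_c and the fibres of src are discrete and closed. *)
Definition is_nu (R : realType) (G G0 : ptopologicalType) (g : groupoid G G0)
    (mu : radon_measure R G0) (nu : radon_measure R G) : Prop :=
  forall f : G -> R, Cc f ->
    (\int[nu]_x (f x)%:E =
     \int[mu]_u (\sum_(k \in [set k | src g k = u]) f k)%:E)%E.

Definition invariant_measure (R : realType) (G G0 : ptopologicalType)
    (g : groupoid G G0) (mu : radon_measure R G0) (nu : radon_measure R G) :
    Prop :=
  is_nu g mu nu /\
  forall A : set (borel G), measurable A -> nu (ginv g @^-1` A) = nu A.

Definition orbit_sum (R : realType) (G G0 : choiceType) (M : Type)
    (g : groupoid G G0) (a : left_action g M) (f : M -> R) (x : M) : R :=
  \sum_(k \in [set k | rng g k = anchor a x]) f (act a (ginv g k) x).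

(* [rho] is induced by the measure m on the orbit space of a, the latter being
   identified with Y by the homeomorphism that q induces; equivalently, m is
   the quotient measure of rho.  F is the function on Y defined by the orbit
   sums of f: it exists, and is unique, when q induces such a homeomorphism. *)
Definition induced_measure (R : realType) (G G0 M Y : ptopologicalType)
    (g : groupoid G G0) (a : left_action g M) (q : M -> Y)
    (m : radon_measure R Y) (rho : radon_measure R M) : Prop :=
  forall (f : M -> R) (F : Y -> R), Cc f ->
    (forall x, F (q x) = orbit_sum a f x) ->
    (\int[rho]_x (f x)%:E = \int[m]_y (F y)%:E)%E.

(* No countability assumption is made on G, so that the product of the Borel
   sigma-algebras of G and M can be too small and measures need not be
   sigma-finite.  Hence, below, the action map is tested on open bisections, and
   properness and measurability of images are tested on sets of finite measure.
   When G is second countable and the measures are sigma-finite, the countably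
   many local witnesses glue, and each notion is the usual one. *)
Definition open_bisection (G : topologicalType) (G0 : Type)
    (g : groupoid G G0) (U : set G) : Prop :=
  [/\ open U, set_inj U (src g) & set_inj U (rng g)].

(* The anchor map is Borel, and so is the action map from
   {(k, x) | k \in U, src k = anchor x}, with the sigma-algebra induced by the
   product one, to M, for all open bisections U. *)
Definition borel_action (G G0 : ptopologicalType) (g : groupoid G G0)
    (d : measure_display) (M : measurableType d) (a : left_action g M) : Prop :=
  measurable_fun [set: M] (anchor a : M -> borel G0) /\
  forall U A, open_bisection g U -> measurable A ->
    exists2 P : set (borel G * M), measurable P &
      forall k x, U k -> src g k = anchor a x -> (A (act a k x) <-> P (k, x)).

(* The set below is U^-1 . A. *)
Definition quasi_invariant (R : realType) (G : topologicalType) (G0 : Type)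
    (g : groupoid G G0) (d : measure_display) (M : measurableType d)
    (a : left_action g M) (rho : {measure set M -> \bar R}) : Prop :=
  forall U A, open_bisection g U -> measurable A -> rho A = 0%E ->
    rho.-negligible [set x | exists k,
      [/\ U k, src g k = anchor a x & A (act a k x)]].

(* Properness in the sense of Anantharaman-Delaroche and Renault: there is a
   cutoff function, that is, a Borel w >= 0 whose sum along orbits is 1. *)
Definition borel_proper (R : realType) (G G0 : choiceType)
    (g : groupoid G G0) (d : measure_display) (M : measurableType d)
    (a : left_action g M) (rho : {measure set M -> \bar R}) : Prop :=
  forall E, measurable E -> (rho E < +oo)%E ->
    exists w : M -> R,
      [/\ measurable_fun [set: M] w, (forall x, 0 <= w x) &
          rho.-negligible [set x | E x /\
            \esum_(k in [set k | rng g k = anchor a x])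
              (w (act a (ginv g k) x))%:E <> 1%E]].

(* q induces an isomorphism from a conull part M1 / a of the orbit space to a
   conull part X1 of X; images of invariant measurable sets under it are
   measurable for the completion of mu. *)
Definition induces_iso_mod_null (R : realType) (G G0 : Type)
    (g : groupoid G G0) (d d' : measure_display) (M : measurableType d)
    (X : measurableType d') (a : left_action g M) (q : M -> X)
    (rho : {measure set M -> \bar R}) (mu : {measure set X -> \bar R}) : Prop :=
  measurable_fun [set: M] q /\
  exists (M1 : set M) (X1 : set X),
    [/\ measurable M1 /\ rho (~` M1) = 0%E,
        measurable X1 /\ mu (~` X1) = 0%E,
        (forall x y, M1 x -> same_orbit a x y -> M1 y),
        q @` M1 = X1 /\
          (forall x y, M1 x -> M1 y -> (q x = q y <-> same_orbit a x y)) &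
        forall (E : set M) (B : set X), measurable E -> E `<=` M1 ->
          (forall x y, E x -> same_orbit a x y -> E y) ->
          measurable B -> (mu B < +oo)%E ->
          exists2 A, measurable A & mu.-negligible ((q @` E `&` B) `+` A)].

Definition same_measure_class (R : realType) (d : measure_display)
    (X : measurableType d) (m1 m2 : set X -> \bar R) : Prop :=
  m1 `<< m2 /\ m2 `<< m1.

(* Excludes measures such as infinite multiples of a sigma-finite one, for
   which conditions on sets of finite measure are void. *)
Definition semifinite (R : realType) (d : measure_display)
    (X : measurableType d) (m : set X -> \bar R) : Prop :=
  forall A, measurable A -> (0 < m A)%E ->
    exists B, [/\ measurable B, B `<=` A & (0 < m B < +oo)%E].

(* (G, nu_mu) with its unit space (G0, mu); mg_nu is determined by mg_mu. *)
Record measured_groupoid (R : realType) := MeasuredGroupoid {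
  mg_arrow : ptopologicalType;
  mg_unit : ptopologicalType;
  mg_groupoid : groupoid mg_arrow mg_unit;
  mg_etale : etale_groupoid mg_groupoid;
  mg_mu : radon_measure R mg_unit;
  mg_nu : radon_measure R mg_arrow;
  mg_invariant : invariant_measure mg_groupoid mg_mu mg_nu
}.

Definition measured_morita_equivalent (R : realType)
    (G H : measured_groupoid R) : Prop :=
  exists (d : measure_display) (M : measurableType d)
      (rho : {measure set M -> \bar R})
      (a : left_action (mg_groupoid G) M)
      (b : right_action (mg_groupoid H) M),
    let p : M -> borel (mg_unit G) := anchor a in
    let q : M -> borel (mg_unit H) := anchor b in
    [/\ semifinite rho,
        commuting_actions a b,
        borel_action a /\ borel_action b,
        quasi_invariant a rho /\ quasi_invariant b rho &
        [/\ free_action a /\ borel_proper a rho,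
            free_action b /\ borel_proper b rho,
            induces_iso_mod_null b p rho (mg_mu G),
            induces_iso_mod_null a q rho (mg_mu H) &
            same_measure_class (pushforward rho p) (mg_mu G) /\
            same_measure_class (pushforward rho q) (mg_mu H)]].

(* Main.v *)
Require Import Defs.
From mathcomp Require Import all_boot all_order all_algebra generic_quotient.
From mathcomp Require Import all_classical all_reals all_analysis.
From mathcomp Require Import measurable_realfun.

Set Implicit Arguments.
Unset Strict Implicit.
Unset Printing Implicit Defensive.

Import Order.TTheory GRing.Theory Num.Theory.
Import numFieldNormedType.Exports.

Local Open Scope classical_set_scope.
Local Open Scope ring_scope.
Local Open Scope quotient_scope.

(** The measured equivalence is the space M itself, with its Borel sets and the
    measure rho obtained by inducing mu to M.

    Let a be one of the two actions and q the anchor map of the other one, which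
    identifies the orbit space of a with the unit space Y on the other side.
    Since a is free and proper and its groupoid is étale, q is open, continuous
    and locally injective, that is, a local homeomorphism whose fibres are the
    orbits ([orbit_map_open], [orbit_map_locally_inj], [orbit_mapP]).  If V is
    open and q is injective on V, then a function supported in V has at most one
    nonzero term in each orbit sum; so a measure rho' on M induced by m is on V
    the pullback of m: rho' E = m (q E) for all Borel E in V ([induced_local]).
    By inner regularity, a set is null when it is null near each of its points
    ([radon_null_locally]).  Hence all questions on null sets of rho' can be
    answered on such V, that is, on Y:
    - the image of rho' in Y has the null sets of m ([induced_null]);
    - the inducing of measures preserves absolute continuity
      ([induced_dominates]);
    - rho' is quasi-invariant under a ([induced_quasi_invariant]).

    The measure rho is induced by mu through the right action and by mu'
    through the left one, so it is quasi-invariant under both, and its images in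
    the two unit spaces have the classes of mu and of mu'.  The class of mu' is
    that of eta: one half is assumed.  For the other, eta' << mu gives
    eta_M << rho on M by inducing through the right action, and taking quotients
    by the left action turns this into eta << mu'.

    Properness and the isomorphism of orbit spaces are required on sets of
    finite measure.  Up to a null set, these are covered by countably many sets
    V as above ([radon_countable_cover]), so that countable constructions with
    Borel sets suffice ([orbit_borel_proper], [orbit_iso_mod_null]).

    A right action is a left action of the opposite groupoid, which is étale
    too; so everything is proved for left actions and used on both sides. *)

(** * Compact sets in locally compact Hausdorff spaces *)

(** Induction over a finite subcover: a compact set has every property of sets
    that is stable under finite unions and subsets and holds locally.  If it
    failed for K, the sets S with P (K \ S) would form a proper filter
    containing K but without cluster point in K. *)
Lemma compact_locally (X : topologicalType) (P : set X -> Prop) (K : set X) :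
  compact K -> P set0 -> (forall A B, P A -> P B -> P (A `|` B)) ->
  (forall A B, A `<=` B -> P B -> P A) ->
  (forall x, K x -> exists2 V, nbhs x V & P V) -> P K.
Proof.
move=> cK P0 PU PS Ploc; apply: contrapT => nPK.
pose F : set_system X := [set S | P (K `\` S)].
have FF : ProperFilter F.
  split; first by rewrite /F/= setD0.
  split.
  - by rewrite /F/= setDT.
  - by move=> A B FA FB; rewrite /F/= setDIr; exact: PU.
  - by move=> A B AB; apply: PS => x [Kx nB]; split => // /AB.
have FK : F K by rewrite /F/= setDv.
have [x [Kx /= cl]] := cK F FF FK.
have [V xV PV] := Ploc x Kx.
have FV : F (~` V) by rewrite /F/= setDE setCK; apply: PS PV => y [].
by have [y []] := cl _ _ FV xV.
Qed.

Lemma open_compact_nbhs (X : topologicalType) (lcX : locally_compact [set: X])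
    (hX : hausdorff_space X) (K U : set X) :
  compact K -> open U -> K `<=` U ->
  exists L, [/\ compact L, K `<=` L° & L `<=` U].
Proof.
move=> cK oU KU.
apply: (@compact_locally X
  (fun S => exists L, [/\ compact L, S `<=` L° & L `<=` U])) => //.
- by exists set0; split => //; exact: compact0.
- move=> A B [L [cL AL LU]] [L' [cL' BL LU']]; exists (L `|` L'); split.
  + exact: compactU.
  + by move=> x [/AL|/BL]; apply: filterS => y; [left|right].
  + by move=> x [/LU|/LU'].
- by move=> A B AB [L [cL BL LU]]; exists L; split => //; exact: subset_trans BL.
move=> x /KU Ux.
have [C] := lcX x I; rewrite withinET => xC [cC clC].
have [B xB BU] := compact_regular hX cC xC (open_nbhs_nbhs (conj oU Ux)).
exists (C `&` closure B)°.
  apply: open_nbhs_nbhs; split; first exact: open_interior.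
  by apply: filterI => //; apply: filterS xB; exact: subset_closure.
exists (C `&` closure B); split => //.
  by apply: compact_closedI => //; exact: closed_closure.
by move=> y [_ /BU].
Qed.

(** Urysohn's lemma in the one-point compactification, which is compact
    Hausdorff and hence normal.  The function vanishes off the interior of a
    compact neighbourhood L of K in U, not merely off U, so that its support is
    compact. *)
Lemma compact_bump (R : realType) (X : topologicalType)
    (lcX : locally_compact [set: X]) (hX : hausdorff_space X) (K U : set X) :
  compact K -> open U -> K `<=` U ->
  exists f : X -> R, [/\ Cc f, forall x, 0 <= f x <= 1,
    forall x, K x -> f x = 1 & forall x, ~ U x -> f x = 0].
Proof.
move=> cK oU KU.
have [L [cL KL LU]] := open_compact_nbhs lcX hX cK oU KU.
pose opc := one_point_compactification X.
have hopc : hausdorff_space opc by exact: one_point_compactification_hausdorff.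
have nopc : normal_space opc.
  by apply: compact_normal => //; exact: one_point_compactification_compact.
pose A : set opc := ~` (Some @` L°).
pose B : set opc := Some @` K.
have clA : closed A.
  apply: open_closedC; apply: one_point_compactification_open_some.
  exact: open_interior.
have clB : closed B.
  apply: compact_closed => //; apply: continuous_compact => //.
  exact/continuous_subspaceT/one_point_compactification_some_continuous.
have AB0 : A `&` B = set0.
  by apply/seteqP; split => // z [+ [x /KL Lx xz]]; apply; exists x.
have /(@uniform_separatorP _ R)[f [cf f01 fA fB]] :=
  (@normal_separatorP R opc).1 nopc A B clA clB AB0.
exists (f \o Some); split.
- split.
    move=> x; apply: (@continuous_comp _ opc _ Some f); last exact: cf.
    exact: one_point_compactification_some_continuous.
  apply: (subclosed_compact _ cL); first exact: closed_closure.
  rewrite ((closure_id L).1 (compact_closed hX cL)); apply: closureS.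
  move=> x /= /eqP fx; apply: contrapT => nLx; apply: fx; apply: fA.
  by exists (Some x) => // -[y /interior_subset Ly [yx]]; apply: nLx; rewrite -yx.
- by move=> x; have := f01 (f (Some x)); rewrite /= in_itv/=; apply; exists (Some x).
- by move=> x Kx; apply: fB; exists (Some x) => //; exists x.
- move=> x nUx; apply: fA; exists (Some x) => // -[y /interior_subset Ly [yx]].
  by apply: nUx; apply: LU; rewrite -yx.
Qed.

(** * Borel sets and Radon measures *)

Lemma borel_open (X : ptopologicalType) (U : set X) :
  open U -> measurable (U : set (borel X)).
Proof. exact: sub_sigma_algebra. Qed.

Lemma borel_compact (X : ptopologicalType) (K : set X) :
  hausdorff_space X -> compact K -> measurable (K : set (borel X)).
Proof.
move=> hX cK; rewrite -(setCK K); apply: measurableC; apply: borel_open.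
by apply: closed_openC; exact: compact_closed.
Qed.

(** For proving that the images of Borel sets under a map, or their translates
    by a set of arrows, are Borel again. *)
Lemma borel_ind (X : ptopologicalType) (P : set X -> Prop) :
  (forall U, open U -> P U) -> (forall A, P A -> P (~` A)) ->
  (forall F : nat -> set X, (forall n, P (F n)) -> P (\bigcup_n F n)) ->
  forall A : set (borel X), measurable A -> P A.
Proof.
move=> PO PC PU A mA; apply: (@smallest_sub _ (sigma_algebra setT) open P) => //.
split.
- exact/PO/open0.
- by move=> B PB; rewrite setTD; exact: PC.
- exact: PU.
Qed.

Lemma measurable_open_gt (R : realType) (X : ptopologicalType) (f : X -> R) :
  (forall r, open [set x | r < f x]) ->
  measurable_fun [set: borel X] (f : borel X -> R).
Proof.
move=> fo; apply: (measurability _ (RGenOInfty.measurableE R)) => //.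
move=> _ [_ [r ->] <-]; rewrite setTI; apply: borel_open.
rewrite (_ : _ @^-1` _ = [set x | r < f x])//.
by apply/seteqP; split => x /=; rewrite in_itv/= andbT.
Qed.

Lemma continuous_borel (X Y : ptopologicalType) (f : X -> Y) :
  continuous f -> measurable_fun [set: borel X] (f : borel X -> borel Y).
Proof.
move=> cf; apply: (@measurability _ _ (borel X) (borel Y) setT f (@open Y)) => //.
move=> _ [B oB <-]; rewrite setTI; apply: borel_open.
by move/continuousP: cf; apply.
Qed.

Section radon.
Context (R : realType) (X : ptopologicalType) (hX : hausdorff_space X).
Variable m : radon_measure R X.

(** The measure of A is the supremum over its compact subsets, each of which is
    covered by finitely many of the sets V. *)
Lemma radon_null_locally (A : set (borel X)) : measurable A ->
  (forall x, A x -> exists V, [/\ open V, V x & m (A `&` V) = 0%E]) ->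
  m A = 0%E.
Proof.
move=> mA loc; rewrite radon_inner//; apply/eqP; rewrite eq_le; apply/andP; split.
  apply: ge_ereal_sup => _ [K [cK KA] <-].
  suff : m.-negligible (A `&` K).
    by rewrite (setIidr KA) => /measure_negligible ->//; exact: borel_compact.
  apply: (@compact_locally X (fun S => m.-negligible (A `&` S))) => //.
  - by rewrite setI0; exact: negligible_set0.
  - by move=> B C; rewrite setIUr; exact: negligibleU.
  - by move=> B C BC; apply: negligibleS => x [Ax /BC].
  move=> x /KA /loc[V [oV Vx V0]]; exists V; first exact: open_nbhs_nbhs.
  by exists (A `&` V); split => //; apply: measurableI => //; exact: borel_open.
apply: ereal_sup_ubound; exists set0; last by rewrite measure0.
by split => //; exact: compact0.
Qed.

Lemma radon_semifinite : semifinite m.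
Proof.
move=> A mA; rewrite [in X in X -> _]radon_inner// => /ereal_sup_gt[_ [K [cK KA] <-] K0].
exists K; split => //; first exact: borel_compact.
by rewrite K0/=; exact: radon_finite.
Qed.

(** Outer regularity of compact sets follows from inner regularity: if L is a
    compact neighbourhood of K in U and C is a compact subset of L \ K of almost
    the same measure, then the interior of L without C is the required set. *)
Lemma radon_outer_compact (lcX : locally_compact [set: X]) (K U : set X)
    (e : R) : compact K -> open U -> K `<=` U -> 0 < e ->
  exists O, [/\ open O, K `<=` O, O `<=` U & (m O <= m K + e%:E)%E].
Proof.
move=> cK oU KU e0.
have [L [cL KL LU]] := open_compact_nbhs lcX hX cK oU KU.
have mK := borel_compact hX cK; have mL := borel_compact hX cL.
have mD : measurable (L `\` K : set (borel X)) by exact: measurableD.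
have finD : m (L `\` K) \is a fin_num.
  rewrite ge0_fin_numE//; apply: (le_lt_trans _ (radon_finite m cL)).
  by apply: le_measure; rewrite ?inE//; exact: subDsetl.
have := finD; rewrite radon_inner// => /(ub_ereal_sup_adherent e0).
rewrite -radon_inner// => -[_ [C [cC CD] <-] mC].
have mC' := borel_compact hX cC.
exists (L° `&` ~` C); split.
- by apply: openI; [exact: open_interior|exact/closed_openC/(compact_closed hX cC)].
- by move=> x Kx; split; [exact: KL|move=> /CD[]].
- by move=> x [/interior_subset /LU].
apply: (@le_trans _ _ (m (K `|` ((L `\` K) `\` C)))).
  apply: le_measure; rewrite ?inE.
  - apply: measurableI; first by apply: borel_open; exact: open_interior.
    exact: measurableC.
  - by apply: measurableU => //; exact: measurableD.
  - move=> x [/interior_subset Lx nC].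
    by have [|] := pselect (K x); [left|right].
apply: (le_trans (measureU2 _ _ _)) => //; first exact: measurableD.
apply: leeD => //; rewrite measureD//; last by rewrite -ge0_fin_numE.
rewrite (setIidr CD); have finC : m C \is a fin_num.
  by rewrite ge0_fin_numE// radon_finite.
rewrite leeBlDr//; rewrite lteBlDr// in mC; rewrite addeC; exact: ltW.
Qed.

(** A set of finite measure is, up to a null set, a countable union of compact
    sets, and these have finite covers by members of C. *)
Lemma radon_countable_cover (C : set (set X)) (E : set (borel X)) :
  C set0 -> (forall x, exists V, [/\ C V, open V & V x]) ->
  measurable E -> (m E < +oo)%E ->
  exists V : nat -> set X,
    (forall n, C (V n)) /\ m.-negligible (E `\` \bigcup_n V n).
Proof.
move=> C0 Cx mE finE.
(* The countably many covers of a union are merged along the encoding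
   [pickle] of pairs of naturals by naturals. *)
pose ccov S := exists V : nat -> set X,
  (forall n, C (V n)) /\ S `<=` \bigcup_n V n.
have ccov_bigcup (S : nat -> set X) : (forall n, ccov (S n)) ->
    ccov (\bigcup_n S n).
  move=> /choice[V VP].
  exists (fun n => if unpickle n is Some (i, j) then V i j else set0); split.
    by move=> n; case: unpickle => [[i j]|//]; have [] := VP i.
  move=> x [i _ /((VP i).2)[j _ Vx]]; exists (pickle (i, j)) => //.
  by rewrite pickleK.
have ccov_sub A B : A `<=` B -> ccov B -> ccov A.
  by move=> AB [V [VC BV]]; exists V; split => //; exact: subset_trans BV.
have ccov0 : ccov set0 by exists (fun=> set0); split.
have ccov_compact K : compact K -> ccov K.
  move=> cK; apply: (compact_locally cK) => //.
    move=> A B cA cB; rewrite -bigcup2E; apply: ccov_bigcup => n.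
    by rewrite /bigcup2; case: n => [|[|n]].
  move=> x _; have [V [CV oV Vx]] := Cx x.
  by exists V; [exact: open_nbhs_nbhs|exists (fun=> V); split => // y; exists 0%N].
have mEfin : m E \is a fin_num by rewrite ge0_fin_numE.
have [K KP] : {K : nat -> set X | forall n,
    [/\ compact (K n), K n `<=` E & (m E - (n.+1%:R^-1)%:E < m (K n))%E]}.
  suff /choice[K KP] : forall n, exists K,
    [/\ compact K, K `<=` E & (m E - (n.+1%:R^-1)%:E < m K)%E] by exists K.
  move=> n; have := mEfin; rewrite radon_inner//.
  have n0 : 0 < n.+1%:R^-1 :> R by rewrite invr_gt0.
  move=> /(ub_ereal_sup_adherent n0); rewrite -radon_inner//.
  by move=> [_ [K [cK KE] <-] mK]; exists K.
have mK n : measurable (K n : set (borel X)).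
  by have [cK _ _] := KP n; exact: borel_compact.
have [V [VC KV]] : ccov (\bigcup_n K n).
  by apply: ccov_bigcup => n; have [cK _ _] := KP n; exact: ccov_compact.
exists V; split => //.
have mD : measurable (E `\` \bigcup_n K n : set (borel X)).
  by apply: measurableD => //; exact: bigcupT_measurable.
exists (E `\` \bigcup_n K n); split => //; last first.
  by move=> x [Ex nV]; split => // /KV.
apply/eqP; rewrite eq_le measure_ge0 andbT; apply/lee_addgt0Pr => e e0.
rewrite add0e.
have [n ne] : exists n : nat, n.+1%:R^-1 < e.
  have [n _ ne] := near_infty_natSinv_lt (PosNum e0).
  by exists n; apply: (ne n) => /=.
have [cK KE mKn] := KP n.
apply: (@le_trans _ _ (m (E `\` K n))).
  apply: le_measure; rewrite ?inE//; first exact: measurableD.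
  by apply: setDS => x Kx; exists n.
rewrite measureD//.
rewrite (setIidr KE); have finK : m (K n) \is a fin_num.
  by rewrite ge0_fin_numE// radon_finite.
rewrite leeBlDr//; rewrite lteBlDr// in mKn.
apply: ltW; apply: (lt_le_trans mKn); rewrite addeC; apply: leeD => //.
by rewrite lee_fin ltW.
Qed.

End radon.

(** A bump function compares the measure of a compact set with that of an open
    set around it. *)
Lemma integral_between_indicators d (R : realType) (T : measurableType d)
    (m : {measure set T -> \bar R}) (f : T -> R) (A B : set T) :
  measurable_fun setT f -> measurable A -> measurable B ->
  (forall x, 0 <= f x <= 1) -> (forall x, A x -> f x = 1) ->
  (forall x, ~ B x -> f x = 0) ->
  (m A <= \int[m]_x (f x)%:E <= m B)%E.
Proof.
move=> mf mA mB f01 fA fB; apply/andP; split.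
  rewrite -[leLHS](congr1 m (setIT A)) -integral_indic//.
  apply: ge0_le_integral => //.
  - exact/measurable_EFinP/measurable_indic.
  - exact/measurable_EFinP.
  move=> x _; rewrite lee_fin indicE; have [/set_mem /fA ->//|_] := boolP (x \in A).
  by have /andP[] := f01 x.
rewrite -[leRHS](congr1 m (setIT B)) -integral_indic//.
apply: ge0_le_integral => //.
- by move=> x _; rewrite lee_fin; have /andP[] := f01 x.
- exact/measurable_EFinP.
- exact/measurable_EFinP/measurable_indic.
move=> x _; rewrite lee_fin indicE; have [xB|/negP nxB] := boolP (x \in B).
  by have /andP[] := f01 x.
by rewrite fB//; move=> Bx; apply: nxB; rewrite inE.
Qed.

(** * Étale groupoids *)

Lemma local_homeo_open (X Y : topologicalType) (f : X -> Y) (U : set X) :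
  local_homeo f -> open U -> open (f @` U).
Proof.
move=> [_ lf] oU; rewrite openE => _ [x Ux <-]; rewrite /interior nbhsE.
have [V [oV Vx _ fV]] := lf x.
exists (f @` (U `&` V)); first split.
- by apply: fV; [exact: subIsetr|exact: openI].
- by exists x.
- by move=> _ [y [Uy _] <-]; exists y.
Qed.

Lemma local_homeo_comp_homeo (X Y : topologicalType) (i : X -> X) (f : X -> Y) :
  continuous i -> involutive i -> local_homeo f -> local_homeo (f \o i).
Proof.
move=> ci iK [cf lf]; split.
  by move=> x; apply: continuous_comp; [exact: ci|exact: cf].
have imi (V : set X) : i @` V = i @^-1` V.
  apply/seteqP; split => [_ [x Vx <-]|x Vx]; first by rewrite /preimage/= iK.
  by exists (i x).
move=> x; have [U [oU Ux injU fU]] := lf (i x).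
exists (i @^-1` U); split => //.
- by move/continuousP: ci; apply.
- move=> y z; rewrite !inE => Uy Uz /= fyz.
  by rewrite -(iK y) -(iK z); congr i; apply: injU; rewrite ?inE.
- move=> V VU oV; rewrite -image_comp imi; apply: fU.
    by move=> y /VU; rewrite /preimage/= iK.
  by move/continuousP: ci; apply.
Qed.

Lemma ginvK (G G0 : Type) (g : groupoid G G0) : involutive (ginv g).
Proof.
move=> k; have sk : src g (ginv g k) = rng g k by rewrite src_inv.
rewrite -[LHS](gmul1 g) src_inv rng_inv -gmulVx gmulA ?src_inv ?rng_inv//.
by rewrite gmulVx src_inv gone_mul.
Qed.

Section etale_groupoids.
Context (G G0 : topologicalType) (g : groupoid G G0) (etg : etale_groupoid g).

Lemma op_groupoid_etale : etale_groupoid (op_groupoid g).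
Proof.
have [lch cr c1 ci cm lh] := etg; split => //=.
- by have [] := lh.
- apply/subspace_continuousP => z /= zc.
  move/subspace_continuousP : cm => /(_ (z.2, z.1)) cm.
  move=> W Wz; have {}cm := cm (esym zc) W Wz.
  rewrite /= !nbhs_simpl in cm *.
  have [[A B] [/= zA zB] AB] := cm.
  exists (B, A) => //= -[x y] [/= Bx Ay] xy.
  by apply: (AB (y, x)) => //=; exact: esym.
- have -> : rng g = src g \o ginv g by apply/funext => k /=; rewrite src_inv.
  exact: local_homeo_comp_homeo (ginvK g) _.
Qed.

Lemma unit_space_hausdorff : hausdorff_space G0.
Proof.
have [[_ hG] _ c1 _ _ _] := etg.
move=> u v uv; rewrite -(src_one g u) -(src_one g v); congr src.
apply: hG => A B uA vB.
by have [w [Aw Bw]] := uv _ _ (c1 u _ uA) (c1 v _ vB); exists (gone g w).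
Qed.

(** Near a unit, src is injective on an open set W; an arrow k of W whose source
    unit is also in W has the same source as that unit, hence is equal to it. *)
Lemma units_open : open (range (gone g)).
Proof.
have [_ _ c1 _ _ lh] := etg; rewrite openE => _ [u _ <-]; rewrite /interior nbhsE.
have [W [oW Wu injW _]] := lh.2 (gone g u).
exists (W `&` src g @^-1` (gone g @^-1` W)); first split.
  apply: openI => //.
  have /continuousP := lh.1; apply; by move/continuousP : c1; apply.
  by split => //; rewrite /preimage/= src_one.
- move=> k [Wk Wsk]; exists (src g k) => //.
  by apply: injW; rewrite ?inE// src_one.
Qed.

End etale_groupoids.

(** * The orbit map of a free and proper action *)

(** This is the set U^-1 . A.  For U everything, it is the saturation of A. *)
Definition translate (G G0 M : Type) (g : groupoid G G0) (a : left_action g M)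
    (U : set G) (A : set M) : set M :=
  [set x | exists k, [/\ U k, src g k = anchor a x & A (act a k x)]].

Section orbits.
Context (G G0 M : Type) (g : groupoid G G0) (a : left_action g M).

Lemma act_inv_act (k : G) (x : M) : src g k = anchor a x ->
  act a (ginv g k) (act a k x) = x.
Proof. by move=> kx; rewrite -act_mul ?src_inv// gmulVx kx act_one. Qed.

Lemma same_orbit_sym (x y : M) : same_orbit a x y -> same_orbit a y x.
Proof.
move=> [k [kx <-]]; exists (ginv g k).
by rewrite src_inv anchor_act// act_inv_act.
Qed.

Lemma same_orbitP (x y : M) : same_orbit a x y <->
  exists k, rng g k = anchor a x /\ act a (ginv g k) x = y.
Proof.
split=> [[k [kx <-]]|[k [kx <-]]].
  by exists (ginv g k); rewrite rng_inv ginvK.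
by exists (ginv g k); rewrite src_inv.
Qed.

Lemma free_act_inj (k l : G) (x : M) : free_action a ->
  rng g k = anchor a x -> rng g l = anchor a x ->
  act a (ginv g k) x = act a (ginv g l) x -> k = l.
Proof.
move=> fr kx lx kl.
have skl : src g k = src g l.
  have := congr1 (anchor a) kl.
  by rewrite !anchor_act ?src_inv// !rng_inv.
have : gmul g k (ginv g l) = gone g (anchor a x).
  apply: fr; first by rewrite src_mul ?rng_inv// src_inv.
  rewrite act_mul ?rng_inv ?src_inv// -kl -act_mul ?rng_inv ?src_inv//.
  by rewrite gmulV kx act_one.
move=> /(congr1 (fun z => gmul g z l)).
rewrite -gmulA ?rng_inv ?src_inv// gmulVx -skl gmul1 => ->.
by rewrite -lx gone_mul.
Qed.

End orbits.

Section orbit_map.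
Context (G G0 M Y : ptopologicalType) (g : groupoid G G0).
Context (a : left_action g M) (q : M -> Y).
Hypotheses (etg : etale_groupoid g) (ca : continuous_action a).
Hypotheses (lchM : locally_compact_hausdorff M).
Hypotheses (fr : free_action a) (pr : proper_action a).
Hypothesis ihq : induces_homeo a q.

(** If k in U moves x into A then, by continuity of the action, so does every
    arrow near k on every point near x; as src is open, the points near x are
    sources of arrows near k. *)
Lemma translate_open (U : set G) (A : set M) :
  open U -> open A -> open (translate a U A).
Proof.
move=> oU oA; rewrite openE => x [k [Uk kx Akx]]; rewrite /interior.
have [cp /subspace_continuousP cact] := ca.
have nA : nbhs (act a k x) A by exact: open_nbhs_nbhs.
have [[N W] [/= kN xW] NW] := cact (k, x) kx _ nA.
have osNU : nbhs (anchor a x) (src g @` (N° `&` U)).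
  apply: open_nbhs_nbhs; split.
    apply: local_homeo_open; first exact: local_homeo_src.
    by apply: openI => //; exact: open_interior.
  by exists k.
have := cp x _ osNU; rewrite /= nbhs_simpl => xN.
near=> y.
have [l [/interior_subset Nl Ul] ly] : (src g @` (N° `&` U)) (anchor a y).
  by near: y.
exists l; split => //; apply: (NW (l, y)) => //; split => //=.
by near: y.
Unshelve. all: by end_near. Qed.

Lemma repr_pi_same_orbit (x : M) :
  same_orbit a x (repr (\pi_(orbit_space a) x : orbit_space a)).
Proof.
have : \pi_(orbit_space a) (repr (\pi_(orbit_space a) x)) =
       \pi_(orbit_space a) x :> orbit_space a by rewrite reprK.
by move=> /esym/eqmodP/asboolP.
Qed.

Lemma orbit_mapP (x y : M) : q x = q y <-> same_orbit a x y.
Proof.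
have [qo [_ [q' [qK _ _]]]] := ihq; split; last exact: qo.
move=> qxy; have : \pi_(orbit_space a) x = \pi_(orbit_space a) y.
  apply: (can_inj qK) => /=.
  by rewrite -(qo _ _ (repr_pi_same_orbit x)) -(qo _ _ (repr_pi_same_orbit y)).
by move=> /eqmodP/asboolP.
Qed.

Lemma orbit_map_continuous : continuous q.
Proof.
have [qo [cq _]] := ihq.
have -> : q = (q \o repr) \o \pi_(orbit_space a).
  by apply/funext => x /=; apply/orbit_mapP/repr_pi_same_orbit.
move=> x; apply: (@continuous_comp _ (orbit_space a)); last exact: cq.
exact: pi_continuous.
Qed.

Lemma orbit_map_surj (y : Y) : exists x, q x = y.
Proof.
by have [_ [_ [q' [_ qK _]]]] := ihq; exists (repr (q' y)); exact: qK.
Qed.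

(** The preimage in M of the image of V in the orbit space is the saturation of
    V, which is open. *)
Lemma orbit_map_open (V : set M) : open V -> open (q @` V).
Proof.
move=> oV; have [_ [_ [q' [qK q'K /continuousP cq']]]] := ihq.
(* The image of V in the orbit space, described by representatives. *)
pose pV : set (orbit_space a) := [set z | translate a setT V (repr z)].
have opV : open pV.
  have oT : open (translate a setT V) by exact: translate_open openT oV.
  suff E : \pi_(orbit_space a) @^-1` pV = translate a setT V.
    by rewrite /open/= /quotient_open E.
  have sat x y : same_orbit a x y -> translate a setT V x ->
      translate a setT V y.
    move=> [l [lx <-]] [k [_ kx Vk]]; exists (gmul g k (ginv g l)).
    have skl : src g k = rng g (ginv g l) by rewrite rng_inv lx.
    rewrite src_mul// src_inv anchor_act//; split => //.
    by rewrite act_mul ?src_inv ?anchor_act// act_inv_act.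
  apply/seteqP; split => x; rewrite /pV/preimage/=; apply: sat.
    exact/same_orbit_sym/repr_pi_same_orbit.
  exact: repr_pi_same_orbit.
suff -> : q @` V = q' @^-1` pV by exact: cq'.
apply/seteqP; split => [_ [x Vx <-]|y [k [_ kx Vk]]]; rewrite /preimage/pV/=.
  have xq : same_orbit a x (repr (q' (q x))).
    by apply/orbit_mapP; exact/esym/q'K.
  have [k [kx kxE]] := same_orbit_sym xq.
  by exists k; split => //; rewrite kxE.
exists (act a k (repr (q' y))) => //.
by rewrite -[RHS]q'K; apply/esym/orbit_mapP; exists k.
Qed.

(** By properness, the pairs (k, y) with k not a unit and y, k . y both in a
    compact neighbourhood L of x form a compact set C: the units are open.  By
    freeness, no such pair satisfies y = k . y = x, so compactness of C provides
    one neighbourhood V of x for which y and k . y are never both in V. *)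
Lemma orbit_map_locally_inj (x : M) : exists V, [/\ open V, V x & set_inj V q].
Proof.
have [lcM hM] := lchM; have [cp /subspace_continuousP cact] := ca.
have [L] := lcM x I; rewrite withinET => xL [cL clL].
pose C := [set z : G * M | src g z.1 = anchor a z.2 /\
  (L `*` L) (act a z.1 z.2, z.2)] `&` [set z | ~ range (gone g) z.1].
have cC : compact C.
  apply: compact_closedI; first by apply: pr; exact: compact_setX.
  have -> : [set z : G * M | ~ range (gone g) z.1] =
    ~` (fst @^-1` range (gone g)) by [].
  apply: open_closedC; apply: open_comp; last exact: units_open.
  by move=> z _; exact: cvg_fst.
pose avoids S := exists V, [/\ open V, V x &
  forall z, C z /\ S z -> V z.2 -> V (act a z.1 z.2) -> False].
have [V [oV Vx VC]] : avoids C.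
  apply: (compact_locally cC).
  - by exists setT; split => //; [exact: openT|move=> z []].
  - move=> A B [V [oV Vx VA]] [W [oW Wx WB]]; exists (V `&` W); split => //.
      exact: openI.
    by move=> z [Cz [Az|Bz]] [Vz Wz] [Vz' Wz']; [exact: (VA z)|exact: (WB z)].
  - move=> A B AB [V [oV Vx VB]]; exists V; split => // z [Cz /AB Bz].
    exact: VB.
  move=> [k y] [[/= ky _] nuk].
  have sep u : u != x -> exists W V, [/\ open W, W u, open V, V x &
      forall z, W z -> V z -> False].
    move=> ux; move: hM; rewrite open_hausdorff => /(_ _ _ ux)[[W V]] /=.
    rewrite !inE => -[Wu Vx] [oW oV WV]; exists W, V; split => // z Wz Vz.
    by have : (W `&` V) z by []; rewrite WV.
  have [yx|yx] := eqVneq y x; last first.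
    have [W [V [oW Wy oV Vx WV]]] := sep _ yx.
    exists (setT `*` W).
      exists (setT, W) => //=; split; first exact: filterT.
      exact: open_nbhs_nbhs.
    by exists V; split => //= -[l z] [_ [_ /= Wz]] Vz _; exact: (WV z).
  have kyx : act a k y != x.
    apply/eqP => kyx; apply: nuk; exists (anchor a y) => //.
    by apply/esym/fr => //; rewrite kyx yx.
  have [W [V [oW Wy oV Vx WV]]] := sep _ kyx.
  have nW : nbhs (act a k y) W by exact: open_nbhs_nbhs.
  have nN := cact (k, y) ky _ nW; rewrite /= nbhs_simpl /= in nN.
  eexists; first exact: nN.
  exists V; split => // z [[[zc _] _] zW] _ Vz; apply: (WV _ _ Vz).
  exact: zW.
exists (V `&` L°); split.
- by apply: openI => //; exact: open_interior.
- by split.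
move=> y z; rewrite !inE => -[Vy Ly] [Vz Lz] /orbit_mapP[k [ky kyz]].
have [[u _ uk]|nu] := pselect (range (gone g) k).
  have uy : u = anchor a y by rewrite -ky -uk src_one.
  by rewrite -kyz -uk uy act_one.
exfalso; have Cky : C (k, y).
  by do 2 split => //=; split; rewrite /= ?kyz; exact: interior_subset.
by apply: (VC (k, y)) => //=; rewrite kyz.
Qed.

End orbit_map.

(** * Measures induced through the orbit map *)

Section orbit_measures.
Context (R : realType) (G G0 M Y : ptopologicalType) (g : groupoid G G0).
Context (a : left_action g M) (q : M -> Y).
Hypotheses (etg : etale_groupoid g) (ca : continuous_action a).
Hypotheses (lchM : locally_compact_hausdorff M).
Hypotheses (fr : free_action a) (pr : proper_action a).
Hypotheses (ihq : induces_homeo a q) (hY : hausdorff_space Y).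

Let lcM : locally_compact [set: M] := lchM.1.
Let hM : hausdorff_space M := lchM.2.
Let qP := orbit_mapP ihq.
Let qc : continuous q := orbit_map_continuous ihq.
Let qs := orbit_map_surj ihq.
Let qo := orbit_map_open etg ca ihq.
Let qinj := orbit_map_locally_inj etg ca lchM fr pr ihq.

Lemma orbit_space_locally_compact : locally_compact [set: Y].
Proof.
move=> y _; rewrite withinET; have [x <-] := qs y.
have [L] := @lcM x I; rewrite withinET => xL [cL clL].
have cqL : compact (q @` L).
  by apply: continuous_compact => //; exact: continuous_subspaceT.
exists (q @` L); last by split => //; exact: compact_closed.
rewrite nbhsE; exists (q @` L°).
  split; first by apply: qo; exact: open_interior.
  by exists x.
by apply: image_subset; exact: interior_subset.
Qed.

Lemma borel_preimage_orbit_map (B : set Y) :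
  measurable (B : set (borel Y)) -> measurable (q @^-1` B : set (borel M)).
Proof. by move=> mB; rewrite -[X in measurable X]setTI; exact: continuous_borel. Qed.

Lemma image_inj_setD (V A : set M) : set_inj V q ->
  q @` (V `\` A) = q @` V `\` q @` (V `&` A).
Proof.
move=> iV; apply/seteqP; split=> [_ [x [Vx nAx] <-]|_ [[x Vx <-] nA]].
  split; first by exists x.
  by move=> [z [Vz Az] /iV zx]; apply: nAx; rewrite -zx ?inE.
by exists x => //; split => // Ax; apply: nA; exists x.
Qed.

Lemma image_inj_borel (V A : set M) : open V -> set_inj V q ->
  measurable (A : set (borel M)) -> measurable (q @` (V `&` A) : set (borel Y)).
Proof.
move=> oV iV; move: A.
apply: (borel_ind (P := fun A => measurable (q @` (V `&` A) : set (borel Y)))).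
- by move=> U oU; apply: borel_open; apply: qo; exact: openI.
- move=> A mA; rewrite -setDE image_inj_setD//; apply: measurableD => //.
  by apply: borel_open; exact: qo.
- by move=> F mF; rewrite setI_bigcupr image_bigcup; exact: bigcupT_measurable.
Qed.

(** Since src is injective on U, at most one arrow of U acts on a given point;
    this is why translation by U commutes with complements. *)
Lemma translate_borel (U : set G) (A : set M) : open U -> set_inj U (src g) ->
  measurable (A : set (borel M)) ->
  measurable (translate a U A : set (borel M)).
Proof.
move=> oU iU; move: A.
apply: (borel_ind (P := fun A => measurable (translate a U A : set (borel M)))).
- by move=> A oA; apply: borel_open; exact: (translate_open etg ca).
- move=> A mA; have -> : translate a U (~` A) =
      translate a U setT `\` translate a U A.
    apply/seteqP; split=> x.
      move=> [k [Uk kx nA]]; split; first by exists k.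
      move=> [l [Ul lx Al]]; apply: nA.
      by rewrite (iU k l) ?inE// kx lx.
    move=> [[k [Uk kx _]] nA]; exists k; split => // Ak; apply: nA.
    by exists k.
  apply: measurableD => //; apply: borel_open.
  by apply: (translate_open etg ca) => //; exact: openT.
- move=> F mF; have -> : translate a U (\bigcup_n F n) =
      \bigcup_n translate a U (F n).
    apply/seteqP; split=> x.
      by move=> [k [Uk kx [n _ Fn]]]; exists n => //; exists k.
    by move=> [n _ [k [Uk kx Fn]]]; exists k; split => //; exists n.
  exact: bigcupT_measurable.
Qed.

(** The orbit sum at x of a function vanishing off V reduces to the term
    indexed by k0. *)
Lemma orbit_meets_once (V : set M) (x z : M) : set_inj V q -> V z -> q z = q x ->
  exists k0, [/\ rng g k0 = anchor a x, act a (ginv g k0) x = z &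
    forall k, rng g k = anchor a x -> V (act a (ginv g k) x) -> k = k0].
Proof.
move=> iV Vz zx; have /qP/same_orbitP[k0 [k0x k0z]] := esym zx.
exists k0; split => // k kx Vk.
apply: (free_act_inj fr kx k0x); rewrite k0z; apply: iV; rewrite ?inE//.
by rewrite zx; apply/esym/qP/same_orbitP; exists k.
Qed.

(** The inverse of q on q V is continuous because q is open; K is the image of L
    under it. *)
Lemma compact_lift (V : set M) (L : set Y) : open V -> set_inj V q ->
  compact L -> L `<=` q @` V ->
  exists K, [/\ compact K, K `<=` V & q @` K = L].
Proof.
move=> oV iV cL LV.
pose s y := xget point [set x | V x /\ q x = y].
have sP y : L y -> V (s y) /\ q (s y) = y.
  move=> /LV[x Vx xy]; rewrite /s; case: xgetP => [z _ [Vz zy]//|/(_ x)[]//].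
exists (s @` L); split.
- apply: continuous_compact => //; apply/subspace_continuousP => y Ly.
  have [Vs sy] := sP y Ly; move=> W; rewrite nbhsE => -[B [oB Bs] BW].
  rewrite /= !nbhs_simpl /=.
  have : nbhs y (q @` (B `&` V)).
    by apply: open_nbhs_nbhs; split; [apply: qo; exact: openI|exists (s y)].
  apply: filterS => z [x [Bx Vx] xz] Lz; apply: BW.
  have [Vsz sz] := sP z Lz.
  have szx : s z = x by apply: iV; rewrite ?inE// sz.
  by rewrite /from_subspace/= szx.
- by move=> _ [y Ly <-]; have [] := sP y Ly.
- rewrite image_comp; apply/seteqP; split => [_ [y Ly <-] /=|y Ly].
    by have [_ ->] := sP y Ly.
  by exists y => //=; have [_ ->] := sP y Ly.
Qed.

Section induced.
Variables (m : radon_measure R Y) (rho : radon_measure R M).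
Hypothesis ind : induced_measure a q m rho.

(** A bump function f equal to 1 on K and vanishing off O has as orbit sums the
    values of the function F on Y obtained by transporting f along the injection
    of O into Y.  The integrals of f and F coincide, the first lies between
    rho K and rho O, and the second between m (q K) and m (q O). *)
Lemma induced_compact_le_open (K O : set M) : compact K -> open O ->
  set_inj O q -> K `<=` O ->
  (rho K <= m (q @` O) /\ m (q @` K) <= rho O)%E.
Proof.
move=> cK oO iO KO.
have [f [Ccf f01 f1 f0]] := compact_bump R lcM hM cK oO KO.
(* The inverse of q on q O.  Off q O its value is a default, which F must avoid:
   the default point may lie in O, where f need not vanish. *)
pose s y := xget point [set x | O x /\ q x = y].
have sK x : O x -> s (q x) = x.
  move=> Ox; rewrite /s; case: xgetP => [z _ [Oz zx]|/(_ x)[]//].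
  by apply: iO; rewrite ?inE.
pose F y := if y \in q @` O then f (s y) else 0.
have FO x : O x -> F (q x) = f x.
  by move=> Ox; rewrite /F mem_set ?sK//; exists x.
have F0 y : ~ (q @` O) y -> F y = 0.
  by move=> nOy; rewrite /F memNset.
have FE x : F (q x) = orbit_sum a f x.
  have [[z Oz zx]|nO] := pselect ((q @` O) (q x)).
    have [k0 [k0x k0z uniq]] := orbit_meets_once iO Oz zx.
    rewrite -zx FO// /orbit_sum -(@fsbig_widen _ _ _ _ [set k0]).
    - by rewrite fsbig_set1 k0z.
    - by move=> _ ->.
    - move=> k [/= kx kk0]; apply: f0 => Ok; apply: kk0; exact: uniq.
  rewrite F0// /orbit_sum fsbig1// => k kx; apply: f0 => Ok; apply: nO.
  by eexists; [exact: Ok|apply/esym/qP/same_orbitP; exists k].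
have mf : measurable_fun [set: borel M] (f : borel M -> R).
  apply: measurable_open_gt => r; have [/continuousP cf _] := Ccf.
  have -> : [set x | r < f x] = f @^-1` [set x | r < x] by [].
  by apply: cf; exact: open_gt.
have F01 y : 0 <= F y <= 1.
  have [[z Oz <-]|nO] := pselect ((q @` O) y); first by rewrite FO.
  by rewrite F0// lexx ler01.
have mF : measurable_fun [set: borel Y] (F : borel Y -> R).
  apply: measurable_open_gt => r; have [r0|r0] := ltP r 0.
    rewrite (_ : [set y | r < F y] = setT); first exact: openT.
    apply/seteqP; split => // y _ /=; apply: (lt_le_trans r0).
    by have /andP[] := F01 y.
  have -> : [set y | r < F y] = q @` (O `&` f @^-1` [set x | r < x]).
    apply/seteqP; split => [y /= rF|_ [x [Ox /= rf] <-]]; last by rewrite /= FO.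
    have [[z Oz zy]|nO] := pselect ((q @` O) y).
      by exists z => //; split => //=; rewrite -FO// zy.
    by move: rF; rewrite F0// ltNge r0.
  apply: qo; apply: openI => //; have [/continuousP cf _] := Ccf.
  by apply: cf; exact: open_gt.
have mK := borel_compact hM cK.
have mqK : measurable (q @` K : set (borel Y)).
  apply: borel_compact => //; apply: continuous_compact => //.
  exact: continuous_subspaceT.
have mO := borel_open oO; have mqO := borel_open (qo oO).
have /andP[rK rO] := integral_between_indicators rho mf mK mO f01 f1 f0.
have /andP[mK' mO'] : (m (q @` K) <= \int[m]_y (F y)%:E <= m (q @` O))%E.
  apply: integral_between_indicators => //.
  by move=> _ [x Kx <-]; rewrite FO ?f1//; exact: KO.
have E := ind Ccf FE; split.
  by apply: (le_trans rK); rewrite E.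
by apply: (le_trans mK'); rewrite -E.
Qed.

(** Both inequalities come from the comparison with open sets, shrunk to K and
    to q K by outer regularity. *)
Lemma induced_compact (V K : set M) : open V -> set_inj V q -> compact K ->
  K `<=` V -> rho K = m (q @` K).
Proof.
move=> oV iV cK KV.
have cqK : compact (q @` K).
  by apply: continuous_compact => //; exact: continuous_subspaceT.
have subinj (O : set M) : O `<=` V -> set_inj O q.
  by move=> OV; apply: sub_in2 iV => x; rewrite !inE => /OV.
apply/eqP; rewrite eq_le; apply/andP; split; apply/lee_addgt0Pr => e e0.
  have qKV : q @` K `<=` q @` V by exact: image_subset.
  have [W [oW KW WV mW]] :=
    radon_outer_compact hY m orbit_space_locally_compact cqK (qo oV) qKV e0.
  have oVO : open (V `&` q @^-1` W).
    by apply: openI => //; move/continuousP : qc; apply.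
  have [rK _] := @induced_compact_le_open K _ cK oVO
    (subinj _ (@subIsetl _ _ _)) (fun x Kx => conj (KV x Kx) (KW _ (imageP q Kx))).
  apply: (le_trans rK); apply: le_trans mW.
  apply: le_measure; rewrite ?inE; [|exact: borel_open|].
    by apply: borel_open; exact: qo.
  by move=> _ [x [_ Wx] <-].
have [W [oW KW WV mW]] := radon_outer_compact hM rho lcM cK oV KV e0.
have [_ mK] := induced_compact_le_open cK oW (subinj _ WV) KW.
exact: le_trans mW.
Qed.

(** A measure induced by m is locally the pullback of m.  By inner regularity it
    suffices to compare compact sets; those in q E are the images of those in
    E. *)
Lemma induced_local (V : set M) (E : set (borel M)) : open V -> set_inj V q ->
  measurable E -> E `<=` V -> rho E = m (q @` E).
Proof.
move=> oV iV mE EV.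
have mqE : measurable (q @` E : set (borel Y)).
  by rewrite -(setIidr EV); exact: image_inj_borel.
rewrite radon_inner// [RHS]radon_inner//; congr ereal_sup.
apply/seteqP; split => _ [K [cK KE] <-].
  exists (q @` K); last by rewrite (induced_compact oV iV cK)//; exact: subset_trans EV.
  split; last exact: image_subset.
  by apply: continuous_compact => //; exact: continuous_subspaceT.
have KqV : K `<=` q @` V by apply: subset_trans KE _; exact: image_subset.
have [K' [cK' K'V K'K]] := compact_lift oV iV cK KqV.
exists K'; last by rewrite (induced_compact oV iV cK')// K'K.
split => // x K'x; have [z Ez zx] : (q @` E) (q x) by apply: KE; rewrite -K'K; exists x.
by rewrite (iV x z) ?inE//; [exact: K'V|exact: EV].
Qed.

Lemma induced_null (B : set (borel Y)) : measurable B ->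
  m B = 0%E <-> rho (q @^-1` B) = 0%E.
Proof.
move=> mB; have mqB := borel_preimage_orbit_map mB; split => B0.
  apply: (radon_null_locally hM) => // x Bx.
  have [V [oV Vx iV]] := qinj x; exists V; split => //.
  have mBV : measurable (q @^-1` B `&` V : set (borel M)).
    by apply: measurableI => //; exact: borel_open.
  rewrite (induced_local oV iV mBV)//.
  apply: subset_measure0 B0 => //.
    by rewrite setIC; exact: image_inj_borel.
  by move=> _ [z [Bz _] <-].
apply: (radon_null_locally hY) => // y By.
have [x xy] := qs y; have [V [oV Vx iV]] := qinj x.
exists (q @` V); split; [exact: qo|by exists x|].
have mBV : measurable (q @^-1` B `&` V : set (borel M)).
  by apply: measurableI => //; exact: borel_open.
have -> : B `&` q @` V = q @` (q @^-1` B `&` V).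
  apply/seteqP; split => [_ [/[swap] -[z Vz <-] Bz]|_ [z [Bz Vz] <-]]; first by exists z.
  by split => //; exists z.
rewrite -(induced_local oV iV mBV)//.
by apply: subset_measure0 B0.
Qed.

Lemma induced_same_class :
  same_measure_class (pushforward rho (q : borel M -> borel Y)) m.
Proof.
split.
  apply/null_content_dominatesP => A mA A0; exact/induced_null.
move=> A nA B mB BA; apply/induced_null => //; exact: nA.
Qed.

(** Locally, U^-1 . A is moved by U into A along orbits, so its image under q is
    contained in that of A, which is null. *)
Lemma induced_quasi_invariant :
  quasi_invariant (M := borel M) a rho.
Proof.
move=> U A [oU iU _] mA A0.
have mT : measurable (translate a U A : set (borel M)) by exact: translate_borel.
exists (translate a U A); split => //.
apply: (radon_null_locally hM) => // x [k [Uk kx Ak]].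
have [W [oW Wkx iW]] := qinj (act a k x).
have [V [oV Vx iV]] := qinj x.
have oVW : open (V `&` translate a U W).
  by apply: openI => //; exact: (translate_open etg ca).
exists (V `&` translate a U W); split => //; first by split => //; exists k.
have mE : measurable (translate a U A `&` (V `&` translate a U W)
    : set (borel M)).
  by apply: measurableI => //; exact: borel_open.
rewrite (induced_local oV iV mE); last by move=> z [_ []].
have mAW : measurable (W `&` A : set (borel M)).
  by apply: measurableI => //; exact: borel_open.
have AW0 : m (q @` (W `&` A)) = 0%E.
  rewrite -(induced_local oW iW mAW); last by move=> z [].
  by apply: subset_measure0 A0.
apply: subset_measure0 AW0; [|exact: image_inj_borel|].
  rewrite setICA; apply: image_inj_borel => //; apply: measurableI => //.
  by apply: borel_open; exact: (translate_open etg ca).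
move=> _ [z [[l [Ul lz Al]] [Vz [l' [Ul' l'z Wl']]]] <-].
have ll' : l = l' by apply: iU; rewrite ?inE// lz l'z.
exists (act a l z); first by split => //; rewrite ll'.
by apply/esym/qP; exists l.
Qed.

End induced.

Lemma induced_dominates (m1 m2 : radon_measure R Y)
    (rho1 rho2 : radon_measure R M) :
  induced_measure a q m1 rho1 -> induced_measure a q m2 rho2 ->
  m1 `<< m2 -> rho1 `<< rho2.
Proof.
move=> ind1 ind2 /null_content_dominatesP m12.
apply/null_content_dominatesP => A mA A0.
apply: (radon_null_locally hM) => // x Ax.
have [V [oV Vx iV]] := qinj x; exists V; split => //.
have mAV : measurable (A `&` V : set (borel M)).
  by apply: measurableI => //; exact: borel_open.
rewrite (induced_local ind1 oV iV mAV)//; apply: m12.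
  by rewrite setIC; exact: image_inj_borel.
apply: (etrans (esym (induced_local ind2 oV iV mAV _))) => //.
by apply: subset_measure0 A0.
Qed.

(** As an arrow of U is determined by its source, membership of k . x in A
    depends on x alone when k is in U. *)
Lemma orbit_borel_action : borel_action (M := borel M) a.
Proof.
split; first exact: continuous_borel ca.1.
move=> U A [oU iU _] mA; exists (setT `*` translate a U A).
  by apply: measurableX => //; exact: translate_borel.
move=> k x Uk kx; split => [Ak|[_ /= [l [Ul lx Al]]]].
  by split => //=; exists k.
by rewrite (iU k l) ?inE// kx lx.
Qed.

(** Let V 0, V 1, ... be open sets on each of which q is injective, covering E
    up to a null set.  Removing from V n the points whose orbit meets an earlier
    V i yields W n, and each orbit meeting some V n meets the union of the W n
    exactly once.  The indicator of this union is the cutoff function. *)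
Lemma orbit_borel_proper (rho : radon_measure R M) :
  borel_proper (M := borel M) a rho.
Proof.
move=> E mE finE.
pose C (V : set M) := open V /\ set_inj V q.
have [V [VC VE]] : exists V : nat -> set M,
    (forall n, C (V n)) /\ rho.-negligible (E `\` \bigcup_n V n).
  apply: (radon_countable_cover hM) => //.
    by split; [exact: open0|move=> x y; rewrite inE].
  by move=> x; have [V [oV Vx iV]] := qinj x; exists V.
pose W n := V n `\` \bigcup_(i < n) q @^-1` (q @` V i).
have mW : measurable (\bigcup_n W n : set (borel M)).
  apply: bigcupT_measurable => n; apply: measurableD.
    by apply: borel_open; have [] := VC n.
  apply: bigcup_measurable => i _; apply: borel_preimage_orbit_map.
  by apply: borel_open; apply: qo; have [] := VC i.
(* W n is taken for the least n such that the orbit of x meets V n. *)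
have WP x : (\bigcup_n V n) x -> exists n z, [/\ W n z, q z = q x &
    forall y, q y = q x -> (\bigcup_n W n) y -> W n y].
  move=> [n0 _ Vx].
  have ex : exists n, `[< (q @` V n) (q x) >].
    by exists n0; apply/asboolP; exists x.
  have [n /asboolP[z Vz zx] nmin] := ex_minnP ex.
  exists n, z; split => //.
    split => // -[i /= ni [y Vy yz]].
    have : (n <= i)%N by apply: nmin; apply/asboolP; exists y; rewrite ?yz.
    by rewrite leqNgt ni.
  move=> y yx [j _ Wjy]; have [nj|jn|->//] := ltngtP n j.
    by exfalso; apply: Wjy.2; exists n => //; exists z => //; rewrite zx yx.
  have : (n <= j)%N.
    by apply: nmin; apply/asboolP; exists y => //; exact: Wjy.1.
  by rewrite leqNgt jn.
exists (\1_(\bigcup_n W n)); split.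
- exact: measurable_indic.
- by move=> x.
- apply: negligibleS VE => x [Ex sum1]; split => // /WP[n [z [Wz zx Wn]]].
  apply: sum1; have [k0 [k0x k0z uniq]] := orbit_meets_once (VC n).2 Wz.1 zx.
  rewrite (eq_esum (b := fun k => if k \in [set k0] then 1%E else 0%E)).
    rewrite -esum_mkcondr (_ : _ `&` _ = [set k0]) ?esum_set1//.
    by apply/seteqP; split => [k []//|k ->].
  move=> k /= kx; rewrite indicE; have [->|/eqP kk0] := eqVneq k k0.
    by rewrite k0z [k0 \in _]mem_set// mem_set//; exists n.
  rewrite [k \in _]memNset// memNset// => Wk.
  have qk : q (act a (ginv g k) x) = q x.
    by apply/esym/qP/same_orbitP; exists k.
  by apply: kk0; apply: uniq => //; exact: (Wn _ qk Wk).1.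
Qed.

(** Images under q are Borel inside each open set q V with q injective on V,
    because q (E) and q V intersect in q (V and E) when E is invariant.
    Countably many of these sets cover B up to a null set. *)
Lemma orbit_iso_mod_null (m : radon_measure R Y) (rho : radon_measure R M) :
  induces_iso_mod_null (M := borel M) (X := borel Y) a q rho m.
Proof.
split; first exact: continuous_borel.
exists setT, setT; split => //.
- by split => //; rewrite setCT measure0.
- by split => //; rewrite setCT measure0.
- split; last by move=> x y _ _; exact: qP.
  by apply/seteqP; split => // y _; have [x <-] := qs y; exists x.
move=> E B mE _ invE mB finB.
pose C (W : set Y) := exists V, [/\ open V, set_inj V q & W = q @` V].
have [W [WC WB]] : exists W : nat -> set Y,
    (forall n, C (W n)) /\ m.-negligible (B `\` \bigcup_n W n).
  apply: (radon_countable_cover hY) => //.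
    exists set0; split; [exact: open0|by move=> x y; rewrite inE|].
    by rewrite image_set0.
  move=> y; have [x xy] := qs y; have [V [oV Vx iV]] := qinj x.
  by exists (q @` V); split; [exists V|exact: qo|exists x].
exists (q @` E `&` B `&` \bigcup_n W n).
  rewrite setIAC; apply: measurableI => //; rewrite setI_bigcupr.
  apply: bigcupT_measurable => n; have [V [oV iV ->]] := WC n.
  rewrite (_ : _ `&` _ = q @` (V `&` E)); first exact: image_inj_borel.
  apply/seteqP; split => [_ [[x Ex <-] [z Vz zx]]|_ [x [Vx Ex] <-]].
    exists z => //; split => //; apply: (invE x) => //.
    exact/qP/esym.
  by split; exists x.
apply: negligibleS WB => y [[[Ey By] nA]|[[[Ey By] Wy] []//]].
by split => // Wy; apply: nA.
Qed.

End orbit_measures.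

(** * The equivalence of measured groupoids *)

Theorem corollary5p12 (R : realType) (G G0 H H0 M : ptopologicalType)
    (g : groupoid G G0) (h : groupoid H H0)
    (etale_g : etale_groupoid g) (etale_h : etale_groupoid h)
    (mu : radon_measure R G0) (nu_mu : radon_measure R G)
    (mu_inv : invariant_measure g mu nu_mu)
    (eta : radon_measure R H0) (nu_eta : radon_measure R H)
    (eta_inv : invariant_measure h eta nu_eta)
    (a : left_action g M) (b : right_action h M)
    (morita_M : morita_equivalence a b)
    (mu_M : radon_measure R M) (mu' : radon_measure R H0)
    (mu_ind : induced_measure b (anchor a) mu mu_M)
    (mu'_quot : induced_measure a (anchor b) mu' mu_M)
    (eta_M : radon_measure R M) (eta' : radon_measure R G0)
    (eta_ind : induced_measure a (anchor b) eta eta_M)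
    (eta'_quot : induced_measure b (anchor a) eta' eta_M) :
  mu' `<< eta -> eta' `<< mu ->
  measured_morita_equivalent
    (MeasuredGroupoid etale_g mu_inv) (MeasuredGroupoid etale_h eta_inv).
Proof.
move=> mu'_eta eta'_mu.
have [lchM ca cb comm fra frb pra prb ihp ihq] := morita_M.
have etg := etale_g; have eth := op_groupoid_etale etale_h.
have hG0 := unit_space_hausdorff etale_g.
have hH0 := unit_space_hausdorff etale_h.
(* eta_M is induced by eta' and mu_M by mu, both through the right action. *)
have eta_M_mu_M : eta_M `<< mu_M.
  exact: (induced_dominates eth cb lchM frb prb ihp hG0 eta'_quot mu_ind).
have class_p := induced_same_class eth cb lchM frb prb ihp hG0 mu_ind.
have [q_mu' mu'_q] := induced_same_class etg ca lchM fra pra ihq hH0 mu'_quot.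
have eta_mu' : eta `<< mu'.
  apply/null_content_dominatesP => B mB B0.
  apply/(induced_null etg ca lchM fra pra ihq hH0 eta_ind mB).
  apply: (null_content_dominatesP _ _).1 eta_M_mu_M _ _ _.
    exact: (borel_preimage_orbit_map ihq).
  exact/(induced_null etg ca lchM fra pra ihq hH0 mu'_quot mB).
exists _, (borel M), mu_M, a, b; split.
- exact: radon_semifinite lchM.2 _.
- exact: comm.
- by split; [exact: (orbit_borel_action etg)|exact: (orbit_borel_action eth)].
- split.
    exact: (induced_quasi_invariant etg ca lchM fra pra ihq hH0 mu'_quot).
  exact: (induced_quasi_invariant eth cb lchM frb prb ihp hG0 mu_ind).
split.
- split; first exact: fra.
  exact: (orbit_borel_proper etg ca lchM fra pra ihq).
- split; first exact: frb.
  exact: (orbit_borel_proper eth cb lchM frb prb ihp).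
- exact: (orbit_iso_mod_null eth cb lchM frb prb ihp hG0).
- exact: (orbit_iso_mod_null etg ca lchM fra pra ihq hH0).
- split; first exact: class_p.
  by split; [exact: null_dominates_trans mu'_eta
            |exact: null_dominates_trans mu'_q].
Qed.
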